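(* Let $(N,M,\boldsymbol q)$ be a setting, $(\varphi,\psi)$ a hybrid-admissible pair of mechanisms, and $\underline\rho\in[0,1]$. Then the algorithm BetaMax (described in the context), run on input $(N,M,\boldsymbol q),\varphi,\psi,\underline\rho$, terminates (completeness) and the value it returns equals the maximal mixing factor $$\beta^{\max}_{(N,M,\boldsymbol q),\varphi,\psi}(\underline\rho)=\max\{\beta\in[0,1]: (1-\beta)\varphi+\beta\psi\text{ is }\underline\rho\text{-partially strategyproof in }(N,M,\boldsymbol q)\}$$ (correctness).
   Context: A setting $(N,M,\boldsymbol q)$ consists of a finite set $N$ of $n$ agents, a finite set $M$ of $m$ objects, and a vector $\boldsymbol q=(q_j)_{j\in M}$ of capacities (positive integers; there are $q_j$ units of object $j$) with $n\le\sum_{j\in M}q_j$. $\mathcal P$ is the set of strict preference orders (linear orders) over $M$; $P:a\succ b$ means that $a$ is strictly preferred to $b$ under $P$; $\mathrm{ch}_P(k)$ is the $k$th most preferred object under $P$. A preference profile is an element $(P_i,P_{-i})\in\mathcal P^N$, where $P_{-i}$ are the orders of all agents except $i$. A utility function $u:M\to\mathbb R^+$ is consistent with $P$ if $u(a)>u(b)$ whenever $P:a\succ b$; $U_P$ is the set of utility functions consistent with $P$. An assignment is an $N\times M$ matrix $x$ with $x_{i,j}\in[0,1]$, $\sum_{j\in M}x_{i,j}=1$ for all $i\in N$, and $\sum_{i\in N}x_{i,j}\le q_j$ for all $j\in M$; $\Delta(X)$ is the set of assignments. A mechanism is a map $\varphi:\mathcal P^N\to\Delta(X)$; $\varphi_i(P_i,P_{-i})$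 is the row of agent $i$, with entries $\varphi_{i,j}(P_i,P_{-i})$. Write $\langle u,v\rangle=\sum_{j\in M}u(j)v_j$. $\varphi$ is strategyproof if $\langle u_i,\varphi_i(P_i,P_{-i})-\varphi_i(P_i',P_{-i})\rangle\ge0$ for all $i\in N$, $(P_i,P_{-i})\in\mathcal P^N$, $P_i'\in\mathcal P$, $u_i\in U_{P_i}$. For $r\in[0,1]$, $u\in U_P$ satisfies URBI($r$) if for all $a,b\in M$ with $P:a\succ b$ we have $r\,(u(a)-\min_{j\in M}u(j))\ge u(b)-\min_{j\in M}u(j)$. A mechanism is $r$-partially strategyproof if the inequality in the definition of strategyproofness holds for all $i$, $(P_i,P_{-i})$, $P_i'$, and all $u_i\in U_{P_i}$ satisfying URBI($r$); by convention every mechanism is $0$-partially strategyproof. The neighborhood $N_P$ of $P\in\mathcal P$ is the set of orders obtained from $P$ by swapping two objects that are adjacent in $P$. A mechanism $\psi$ is upper invariant if for all $i$, $(P_i,P_{-i})$, and $P_i'\in N_{P_i}$ with $P_i:a\succ b$ and $P_i':b\succ a$, we have $\psi_{i,j}(P_i,P_{-i})=\psi_{i,j}(P_i',P_{-i})$ for all $j\in M$ with $P_i:j\succ a$. $\psi$ is weakly less varying than $\varphi$ if for all $i$, $(P_i,P_{-i})$, and $P_i'\in N_{P_i}$: $\varphi_i(P_i,P_{-i})=\varphi_i(P_i',P_{-i})$ implies $\psi_i(P_i,P_{-i})=\psi_i(P_i',P_{-i})$. The pair $(\varphi,\psi)$ is hybrid-admissible if $\varphi$ is strategyproof, $\psi$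 is upper invariant, and $\psi$ is weakly less varying than $\varphi$. Algorithm BetaMax. Initialize a variable $\beta^{\max}\leftarrow1$. Loop over all $i\in N$, $(P_i,P_{-i})\in\mathcal P^N$, $P_i'\in\mathcal P$; in each iteration, set for all $j\in M$: $\delta^\varphi_j\leftarrow\varphi_{i,j}(P_i,P_{-i})-\varphi_{i,j}(P_i',P_{-i})$ and $\delta^\psi_j\leftarrow\psi_{i,j}(P_i,P_{-i})-\psi_{i,j}(P_i',P_{-i})$; then for each $K\in\{1,\dots,m\}$ set $p^\varphi_K\leftarrow\sum_{k=1}^K\delta^\varphi_{\mathrm{ch}_{P_i}(k)}\underline\rho^{\,k}$ and $p^\psi_K\leftarrow\sum_{k=1}^K\delta^\psi_{\mathrm{ch}_{P_i}(k)}\underline\rho^{\,k}$, and if $p^\psi_K<0$ set $\beta^{\max}\leftarrow\min\{\beta^{\max},\,p^\varphi_K/(p^\varphi_K-p^\psi_K)\}$. After all loops, return $\beta^{\max}$. *)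

(* Defs.v *)
From HB Require Import structures.
From Stdlib Require Import Relation_Operators.
From mathcomp Require Import all_boot all_order all_algebra perm.
From mathcomp Require Import mathcomp_extra boolp classical_sets reals.
From mathcomp Require Import ring lra.

Set Implicit Arguments.
Unset Strict Implicit.
Unset Printing Implicit Defensive.

Import Order.TTheory GRing.Theory Num.Theory.
Local Open Scope ring_scope.

Definition setting (N M : finType) (q : M -> nat) : Prop :=
  (forall j, (0 < q j)%N) /\ (#|N| <= \sum_(j : M) q j)%N.

(* The pair [(a, b)] belongs to a strict preference order when [a] is strictly
   preferred to [b]. *)
Definition strict_linear_order (M : finType) (P : {set M * M}) : bool :=
  [&& [forall a, (a, a) \notin P],
      [forall a, forall b, forall c,
         ((a, b) \in P) && ((b, c) \in P) ==> ((a, c) \in P)] &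
      [forall a, forall b, (a != b) ==> ((a, b) \in P) || ((b, a) \in P)]].

Record pref (M : finType) := Pref {
  pref_pairs : {set M * M};
  pref_linear : strict_linear_order pref_pairs
}.

HB.instance Definition _ (M : finType) := [isSub for @pref_pairs M].
HB.instance Definition _ (M : finType) := [Finite of pref M by <:].

(* With the coercion below, [P a b] stands for "P : a > b". *)
Definition prefers (M : finType) (P : pref M) : rel M :=
  fun a b => (a, b) \in pref_pairs P.
Coercion prefers : pref >-> rel.

(* Ranks count from 0: [ch P k] is the object in position [k + 1] of [P]. *)
Definition ch (M : finType) (P : pref M) (k : 'I_#|M|) : M :=
  tnth (sort_tuple (fun a b => (a == b) || P a b) (enum_tuple M)) k.

Definition profile (N M : finType) := {ffun N -> pref M}.

(* [upd P i Q] is the profile in which agent [i] reports [Q] and all the other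
   agents report as in [P]. *)
Definition upd (N M : finType) (P : profile N M) (i : N) (Q : pref M) :
    profile N M :=
  [ffun k => if k == i then Q else P k].

Definition assignment (R : realType) (N M : finType) (q : M -> nat)
    (x : N -> M -> R) : Prop :=
  [/\ forall i j, 0 <= x i j <= 1,
      forall i, \sum_(j : M) x i j = 1 &
      forall j, \sum_(i : N) x i j <= (q j)%:R].

Record mechanism (R : realType) (N M : finType) (q : M -> nat) := Mechanism {
  mech_fun :> profile N M -> N -> M -> R;
  mech_assignment : forall P, assignment q (mech_fun P)
}.

Definition inner (R : realType) (M : finType) (u v : M -> R) : R :=
  \sum_(j : M) u j * v j.

(* [U_P]; utilities take values in the positive reals. *)
Definition consistent (R : realType) (M : finType) (P : pref M) (u : M -> R) :
    Prop :=
  (forall j, 0 < u j) /\ (forall a b, P a b -> u b < u a).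

(* Agent [i], truthful order [P i], gains nothing by reporting [Q]. *)
Definition no_gain (R : realType) (N M : finType) (q : M -> nat)
    (phi : mechanism R N q) (i : N) (P : profile N M) (Q : pref M)
    (u : M -> R) : Prop :=
  0 <= inner u (fun j => phi P i j - phi (upd P i Q) i j).

Definition strategyproof (R : realType) (N M : finType) (q : M -> nat)
    (phi : mechanism R N q) : Prop :=
  forall (i : N) (P : profile N M) (Q : pref M) (u : M -> R),
    consistent (P i) u -> no_gain phi i P Q u.

(* The minimum of [u] over [M]; the object [a] only witnesses that [M] is
   nonempty, and the value does not depend on it. *)
Definition min_utility (R : realType) (M : finType) (u : M -> R) (a : M) : R :=
  \big[Num.min/u a]_(j : M) u j.

Definition URBI (R : realType) (M : finType) (r : R) (P : pref M)
    (u : M -> R) : Prop :=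
  forall a b, P a b ->
    r * (u a - min_utility u a) >= u b - min_utility u a.

(* The left disjunct is the convention that every mechanism is 0-partially
   strategyproof; it is not redundant when there are two objects. *)
Definition partially_strategyproof (R : realType) (N M : finType)
    (q : M -> nat) (r : R) (phi : mechanism R N q) : Prop :=
  r = 0 \/
  forall (i : N) (P : profile N M) (Q : pref M) (u : M -> R),
    consistent (P i) u -> URBI r (P i) u -> no_gain phi i P Q u.

(* [Q] arises from [P] by swapping [a] and [b], which are adjacent in [P]. *)
Definition adjacent_swap (M : finType) (P Q : pref M) (a b : M) : bool :=
  [&& P a b, [forall c, ~~ (P a c && P c b)] &
      [forall x, forall y, Q x y == P (tperm a b x) (tperm a b y)]].

Definition neighborhood (M : finType) (P : pref M) : {set pref M} :=
  [set Q | [exists a, exists b, adjacent_swap P Q a b]].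

Definition upper_invariant (R : realType) (N M : finType) (q : M -> nat)
    (psi : mechanism R N q) : Prop :=
  forall (i : N) (P : profile N M) (Q : pref M) (a b : M),
    Q \in neighborhood (P i) -> P i a b -> Q b a ->
    forall j, P i j a -> psi P i j = psi (upd P i Q) i j.

Definition weakly_less_varying (R : realType) (N M : finType) (q : M -> nat)
    (psi phi : mechanism R N q) : Prop :=
  forall (i : N) (P : profile N M) (Q : pref M),
    Q \in neighborhood (P i) ->
    phi P i =1 phi (upd P i Q) i -> psi P i =1 psi (upd P i Q) i.

Definition hybrid_admissible (R : realType) (N M : finType) (q : M -> nat)
    (phi psi : mechanism R N q) : Prop :=
  [/\ strategyproof phi, upper_invariant psi & weakly_less_varying psi phi].

Lemma hybrid_assignment (R : realType) (N M : finType) (q : M -> nat)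
    (phi psi : mechanism R N q) (beta : R) (hb : 0 <= beta <= 1)
    (P : profile N M) :
  assignment q (fun i j => (1 - beta) * phi P i j + beta * psi P i j).
Proof.
have [f01 f1 fq] := mech_assignment phi P.
have [g01 g1 gq] := mech_assignment psi P.
case/andP: hb => b0 b1; split=> [i j|i|j].
- by have := f01 i j; have := g01 i j; nra.
- by rewrite big_split -!mulr_sumr /= f1 g1; lra.
- by rewrite big_split -!mulr_sumr /=; have := fq j; have := gq j; nra.
Qed.

(* The mixture (1 - beta) phi + beta psi. *)
Definition hybrid (R : realType) (N M : finType) (q : M -> nat)
    (phi psi : mechanism R N q) (beta : R) (hb : 0 <= beta <= 1) :
    mechanism R N q :=
  Mechanism (hybrid_assignment phi psi hb).

Definition mixing_factors (R : realType) (N M : finType) (q : M -> nat)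
    (phi psi : mechanism R N q) (rho : R) : set R :=
  [set beta | exists hb : 0 <= beta <= 1,
     partially_strategyproof rho (hybrid phi psi hb)]%classic.

Definition is_maximal_mixing_factor (R : realType) (N M : finType)
    (q : M -> nat) (phi psi : mechanism R N q) (rho b : R) : Prop :=
  mixing_factors phi psi rho b /\ ubound (mixing_factors phi psi rho) b.

(* BetaMax is rendered as a nondeterministic abstract machine over exact real
   arithmetic: each of the two loops visits its indices in an arbitrary order.
   A configuration of the outer loop holds the iterations [(i, P, Q)] still to
   be run and the current value of the variable betamax; one of the inner loop
   also holds the order [P i], the vectors delta^phi and delta^psi of the
   current iteration, and the values of [K] still to be visited. *)
Definition iteration (N M : finType) : finType := (N * profile N M * pref M)%type.

Inductive config (R : realType) (N M : finType) : Type :=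
| OuterLoop of {set iteration N M} & R
| InnerLoop of {set iteration N M} & pref M & (M -> R) & (M -> R)
             & {set 'I_#|M|} & R
| Return of R.

Definition delta (R : realType) (N M : finType) (q : M -> nat)
    (phi : mechanism R N q) (t : iteration N M) : M -> R :=
  let: (i, P, Q) := t in fun j => phi P i j - phi (upd P i Q) i j.

(* Position [k] counts from 0, hence the exponent [k.+1]; likewise the argument
   [K] stands for the upper summation bound [K + 1]. *)
Definition partial_sum (R : realType) (M : finType) (rho : R) (P : pref M)
    (d : M -> R) (K : 'I_#|M|) : R :=
  \sum_(k < #|M| | (k <= K)%N) d (ch P k) * rho ^+ k.+1.

(* Division by zero is an error: the machine has no transition there, rather
   than the conventional value [x / 0 = 0]. *)
Inductive step (R : realType) (N M : finType) (q : M -> nat)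
    (phi psi : mechanism R N q) (rho : R) : config R N M -> config R N M -> Prop :=
| StepEnter (todo : {set iteration N M}) (b : R) (i : N) (P : profile N M)
    (Q : pref M) :
    (i, P, Q) \in todo ->
    step phi psi rho (OuterLoop todo b)
      (InnerLoop (todo :\ (i, P, Q)) (P i)
         (delta phi (i, P, Q)) (delta psi (i, P, Q)) [set: 'I_#|M|] b)
| StepUpdate todo Pi dphi dpsi (Ks : {set 'I_#|M|}) (K : 'I_#|M|) b :
    let pphi := partial_sum rho Pi dphi K in
    let ppsi := partial_sum rho Pi dpsi K in
    K \in Ks -> ppsi < 0 -> pphi - ppsi != 0 ->
    step phi psi rho (InnerLoop todo Pi dphi dpsi Ks b)
      (InnerLoop todo Pi dphi dpsi (Ks :\ K)
         (Num.min b (pphi / (pphi - ppsi))))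
| StepSkip todo Pi dphi dpsi (Ks : {set 'I_#|M|}) (K : 'I_#|M|) b :
    K \in Ks -> ~~ (partial_sum rho Pi dpsi K < 0) ->
    step phi psi rho (InnerLoop todo Pi dphi dpsi Ks b)
      (InnerLoop todo Pi dphi dpsi (Ks :\ K) b)
| StepLeave todo Pi dphi dpsi b :
    step phi psi rho (InnerLoop todo Pi dphi dpsi finset.set0 b)
      (OuterLoop todo b)
| StepReturn b :
    step phi psi rho (OuterLoop finset.set0 b) (Return N M b).

Definition BetaMax_init (R : realType) (N M : finType) : config R N M :=
  OuterLoop [set: iteration N M] 1.

(* Every execution from the configuration is finite and ends in [Return]; in
   particular none gets stuck on a division by zero. *)
Inductive halts (R : realType) (N M : finType) (q : M -> nat)
    (phi psi : mechanism R N q) (rho : R) : config R N M -> Prop :=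
| HaltsReturn b : halts phi psi rho (Return N M b)
| HaltsStep c :
    (exists c', step phi psi rho c c') ->
    (forall c', step phi psi rho c c' -> halts phi psi rho c') ->
    halts phi psi rho c.

Definition BetaMax_terminates (R : realType) (N M : finType) (q : M -> nat)
    (phi psi : mechanism R N q) (rho : R) : Prop :=
  halts phi psi rho (BetaMax_init R N M).

Definition BetaMax_returns (R : realType) (N M : finType) (q : M -> nat)
    (phi psi : mechanism R N q) (rho b : R) : Prop :=
  clos_refl_trans _ (step phi psi rho) (BetaMax_init R N M) (Return N M b).

(* Main.v *)
(* For [rho > 0], Abel summation along the preference order shows that a
   mechanism is [rho]-partially strategyproof iff every partial sum [p_K] of
   every misreport is nonnegative: up to additive constants, the vectors
   (rho, ..., rho^K, 0, ..., 0) generate the closed cone of URBI(rho) utilities.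
   Partial sums are linear in the mechanism, and those of [phi] are nonnegative by
   strategyproofness, so the constraint on the mixing factor [beta] given by a
   pair [p^phi_K], [p^psi_K] is void if [p^psi_K >= 0] and reads
   [beta <= p^phi_K / (p^phi_K - p^psi_K)] otherwise.  BetaMax takes the minimum
   of 1 and these bounds.  For [rho = 0] all partial sums vanish and BetaMax
   returns 1. *)
Require Import Defs.
From Stdlib Require Import Relation_Operators.
From mathcomp Require Import all_boot all_order all_algebra reals.
From mathcomp Require Import ring lra.
Set Implicit Arguments.
Unset Strict Implicit.
Unset Printing Implicit Defensive.
Import Order.TTheory GRing.Theory Num.Theory.
Local Open Scope ring_scope.

(** * Ranks in a preference order *)

Lemma ch_prefers (M : finType) (P : pref M) (k l : 'I_#|M|) :
  (k < l)%N -> P (ch P k) (ch P l).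
Proof.
case/and3P: (pref_linear P) => /forallP irr /forallP tr /forallP tot ltkl.
pose leP a b := (a == b) || P a b.
have leP_tr : transitive leP.
  move=> b a c; rewrite /leP => /orP[/eqP->//|ab] /orP[/eqP<-|bc].
    by rewrite ab orbT.
  have /forallP/(_ b)/forallP/(_ c)/implyP := tr a.
  by rewrite /prefers in ab bc *; rewrite ab bc => ->; rewrite ?orbT.
have leP_tot : total leP.
  move=> a b; rewrite /leP; case: eqVneq => //= ab.
  have /forallP/(_ b)/implyP/(_ ab)/orP[] := tot a; rewrite /prefers => ->//.
  by rewrite !orbT.
have leP_refl : reflexive leP by move=> a; rewrite /leP eqxx.
set s := sort_tuple leP (enum_tuple M).
have s_sorted : sorted leP s by apply: sort_sorted.
have s_uniq : uniq s by rewrite sort_uniq enum_uniq.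
have sz : size s = #|M| by rewrite size_tuple.
have chE (j : 'I_#|M|) : nth (ch P k) s j = ch P j.
  by symmetry; apply: tnth_nth.
have := sorted_leq_nth leP_tr leP_refl (ch P k) s_sorted k l.
rewrite !inE sz !ltn_ord => /(_ isT isT (ltnW ltkl)).
(* Sorting yields only weak preference; equality is excluded because the entries are distinct. *)
rewrite /leP => /orP[|]; last by rewrite !chE.
by rewrite nth_uniq ?sz // => /eqP e; rewrite e ltnn in ltkl.
Qed.

Lemma prefers_irr (M : finType) (P : pref M) a : ~~ P a a.
Proof. by case/and3P: (pref_linear P) => /forallP/(_ a). Qed.

Lemma prefers_asym (M : finType) (P : pref M) a b : P a b -> ~~ P b a.
Proof.
move=> ab; apply/negP => ba.
case/and3P: (pref_linear P) => _ /forallP/(_ a)/forallP/(_ b)/forallP/(_ a).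
rewrite /prefers in ab ba; rewrite ab ba /= => aa _.
by have := prefers_irr P a; rewrite /prefers aa.
Qed.

Lemma ch_inj (M : finType) (P : pref M) : injective (ch P).
Proof.
move=> k l kl; apply/val_inj.
by case: (ltngtP k l) => // /(ch_prefers P);
  rewrite kl (negbTE (prefers_irr _ _)).
Qed.

Lemma ch_bij (M : finType) (P : pref M) : bijective (ch P).
Proof. by apply: inj_card_bij; [exact: ch_inj | rewrite card_ord]. Qed.

Lemma prefers_ch (M : finType) (P : pref M) (k l : 'I_#|M|) :
  P (ch P k) (ch P l) = (k < l)%N.
Proof.
apply/idP/idP; last exact: ch_prefers.
case: ltngtP => // [lk|/val_inj->]; last by rewrite (negbTE (prefers_irr _ _)).
by rewrite (negbTE (prefers_asym (ch_prefers P lk))).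
Qed.

Lemma inner_ch (R : realType) (M : finType) (P : pref M) (u d : M -> R) :
  inner u d = \sum_(k < #|M|) u (ch P k) * d (ch P k).
Proof. by rewrite /inner (reindex (ch P)) //; apply/onW_bij/ch_bij. Qed.

(** * Minimum utility and Abel summation *)

Lemma min_utility_le (R : realType) (M : finType) (u : M -> R) (a j : M) :
  min_utility u a <= u j.
Proof. by rewrite /min_utility (bigD1 j) //= ge_min lexx. Qed.

Lemma min_utility_ge (R : realType) (M : finType) (u : M -> R) (a : M) c :
  (forall j, c <= u j) -> c <= min_utility u a.
Proof.
move=> cu; rewrite /min_utility; elim/big_rec: _ => // j x _ cx.
by rewrite le_min cu.
Qed.

Lemma min_utility_indep (R : realType) (M : finType) (u : M -> R) (a b : M) :
  min_utility u a = min_utility u b.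
Proof.
by apply/eqP; rewrite eq_le; apply/andP; split; apply: min_utility_ge => j;
  exact: min_utility_le.
Qed.

Lemma abel_sum_ge (R : realDomainType) (n : nat) (w f : nat -> R) :
  (forall k, (k < n)%N -> w k.+1 <= w k) ->
  (forall k, (k < n)%N -> 0 <= \sum_(j < k.+1) f j) ->
  w n * \sum_(j < n.+1) f j <= \sum_(j < n.+1) w j * f j.
Proof.
elim: n => [|n IH] w_anti f_ge0; first by rewrite !big_ord1.
rewrite big_ord_recr [leRHS]big_ord_recr /= mulrDr lerD2r.
apply: le_trans (IH _ _); last 2 first.
- by move=> k kn; apply/w_anti/ltnW.
- by move=> k kn; apply/f_ge0/ltnW.
(* The shorter sum is nonnegative, so lowering its weight from [w n] to [w n.+1] can only decrease
   the product. *)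
by apply: ler_wpM2r; [exact: f_ge0 | exact: w_anti].
Qed.

(** * Partial sums tested against URBI utilities *)

Section PartialSums.
Variables (R : realType) (M : finType) (rho : R) (P : pref M) (d : M -> R).
Hypotheses (rho_gt0 : 0 < rho) (rho_le1 : rho <= 1).

(** Abel summation with weights [(u - min u) / rho ^+ k.+1]: URBI at consecutive ranks makes them
    nonincreasing, and the remaining factors have the [p_K] as partial sums. *)
Lemma partial_sums_inner_ge0 (u : M -> R) :
  \sum_j d j = 0 -> URBI rho P u ->
  (forall K, 0 <= partial_sum rho P d K) -> 0 <= inner u d.
Proof.
move=> d0 urbi p_ge0; rewrite (inner_ch P).
case: (posnP #|M|) => [M0|M_gt0].
  by rewrite big1 // => k _; have := ltn_ord k; rewrite {2}M0.
pose a := ch P (Ordinal M_gt0); pose c := min_utility u a.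
(* Ranks are extended to all naturals to fit [abel_sum_ge]; the default value is taken only from
   index [#|M|] on, outside the sums. *)
pose x k := if insub k is Some i then ch P i else a.
have xE (k : 'I_#|M|) : x k = ch P k by rewrite /x valK.
pose w k := (u (x k) - c) / rho ^+ k.+1.
pose f k := d (x k) * rho ^+ k.+1.
have -> : \sum_(k < #|M|) u (ch P k) * d (ch P k) = \sum_(k < #|M|) w k * f k.
  (* Subtracting the constant [c] changes nothing because [d] sums to zero. *)
  transitivity (\sum_(k < #|M|) (u (ch P k) - c) * d (ch P k)).
    under [RHS]eq_bigr do rewrite mulrBl.
    rewrite sumrB -mulr_sumr.
    suff -> : \sum_(k < #|M|) d (ch P k) = 0 by rewrite mulr0 subr0.
    by rewrite -[RHS]d0 [RHS](reindex (ch P)) //; apply/onW_bij/ch_bij.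
  apply: eq_bigr => k _; rewrite /w /f xE; field.
  by rewrite expf_neq0 // gt_eqF.
have f_ge0 k : (k < #|M|)%N -> 0 <= \sum_(j < k.+1) f j.
  move=> kM; have := p_ge0 (Ordinal kM); rewrite /partial_sum /=.
  rewrite (big_ord_widen _ f kM).
  by under [X in _ -> 0 <= X]eq_bigr do rewrite /f xE.
rewrite -(prednK M_gt0) in f_ge0 *.
apply: le_trans (abel_sum_ge _ _) => [|k kn|k kn]; last exact/f_ge0/ltnW.
  apply: mulr_ge0; last exact: f_ge0.
  by apply: divr_ge0; rewrite ?subr_ge0 ?min_utility_le // exprn_ge0 ?ltW.
have k1M : (k.+1 < #|M|)%N by rewrite -(prednK M_gt0).
have := urbi (ch P (Ordinal (ltnW k1M))) (ch P (Ordinal k1M)).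
rewrite prefers_ch /= => /(_ (leqnn _)).
rewrite (min_utility_indep u _ a) -/c -!xE /= => h.
rewrite /w ler_pdivrMr ?exprn_gt0 // [rho ^+ k.+2]exprS mulrCA.
by rewrite divfK ?expf_neq0 ?gt_eqF.
Qed.

(** Subtracting the minimum [c] from both utilities leaves a slack of [(1 - rho) * c], which is
    nonnegative. *)
Lemma URBI_geometric (u : M -> R) :
  (forall j, 0 <= u j) -> (forall a b, P a b -> u b <= rho * u a) ->
  URBI rho P u.
Proof.
move=> u0 ur a b ab; have := ur a b ab; have c0 := min_utility_ge a u0.
have : 0 <= (1 - rho) * min_utility u a by rewrite mulr_ge0 // subr_ge0.
by lra.
Qed.

(* The truncated geometric vector [A] is only weakly decreasing, so it is
   perturbed by a small multiple of the strictly decreasing [B]. *)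
Lemma inner_ge0_partial_sums :
  (forall u, consistent P u -> URBI rho P u -> 0 <= inner u d) ->
  forall K, 0 <= partial_sum rho P d K.
Proof.
move=> ge0 K; have [rank chK rankK] := ch_bij P.
(* Halving puts [s] below [rho], which preserves the decay by [rho], and below 1 even when
   [rho = 1], which gives strict decrease. *)
pose s := rho / 2.
have s01 : 0 < s < 1.
  by move: rho_gt0 rho_le1; rewrite /s; lra.
pose A (k : nat) := if (k <= K)%N then rho ^+ k.+1 else 0 : R.
pose B (k : nat) := s ^+ k.
have A_ge0 k : 0 <= A k.
  by rewrite /A; case: ifP => // _; rewrite exprn_ge0 ?ltW.
have B_gt0 k : 0 < B k by rewrite exprn_gt0 //; case/andP: s01.
have AS k l : (k < l)%N -> A l <= rho * A k.
  move=> kl; rewrite /A; case: leqP => [lK|_]; last first.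
    by rewrite mulr_ge0 ?A_ge0 ?ltW.
  rewrite (leq_trans (ltnW kl) lK) -exprS.
  by apply: ler_wiXn2l => //; rewrite ltW.
have BS k l : (k < l)%N -> B l <= s * B k.
  case/andP: s01 => s0 s1 kl; rewrite /B -exprS.
  by apply: ler_wiXn2l => //; rewrite ltW.
(* Testing against [A + e B] yields [p_K] plus a multiple of [e]; afterwards [e] is taken small. *)
have key e : 0 < e ->
    0 <= partial_sum rho P d K + e * \sum_(k < #|M|) B k * d (ch P k).
  move=> e0; pose u j := A (rank j) + e * B (rank j).
  suff: 0 <= inner u d.
    rewrite (inner_ch P) /u.
    under eq_bigr do rewrite chK mulrDl -mulrA.
    rewrite big_split -mulr_sumr /=; congr (_ <= _ + _).
    rewrite /partial_sum [RHS]big_mkcond /=; apply: eq_bigr => k _.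
    by rewrite /A; case: ifP; rewrite ?mul0r // mulrC.
  have u_gt0 j : 0 < u j by rewrite ltr_wpDl ?mulr_gt0.
  have u_rho a b : P a b -> u b <= rho * u a /\ u b < u a.
    rewrite -{1}[a]rankK -{1}[b]rankK prefers_ch => ab.
    have := AS _ _ ab; have := BS _ _ ab; have := A_ge0 (rank a).
    have := B_gt0 (rank a); rewrite /u.
    move: (A (rank a)) (A (rank b)) (B (rank a)) (B (rank b)) => x y z t.
    move=> z0 x0 tz yx.
    have etz : e * t <= s * (e * z) by rewrite (mulrCA s) ler_pM2l.
    have ez : 0 < e * z by rewrite mulr_gt0.
    have rx : rho * x <= x by rewrite ler_piMl.
    by move: etz ez rho_gt0 rho_le1; rewrite /s; split; nra.
  apply: ge0; first by split=> // a b /u_rho[].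
  by apply: URBI_geometric => [j|a b /u_rho[]//]; rewrite ltW.
set p := partial_sum _ _ _ _ in key *; move: (\sum_(k < _) _) key => Y key.
rewrite leNgt; apply/negP => p_lt0.
have Y0 : 0 < `|Y| + 1 by rewrite ltr_wpDl.
(* With this [e] the perturbation [e * Y] is at most [- p / 2], so the total would be at most
   [p / 2 < 0]. *)
have := key (- p / 2 / (`|Y| + 1)); rewrite !divr_gt0 ?oppr_gt0 // => /(_ isT).
apply/negP; rewrite -ltNge.
have : - p / 2 / (`|Y| + 1) * Y <= - p / 2.
  rewrite mulrAC ler_pdivrMr // ler_wpM2l //; first by lra.
  by have := ler_norm Y; lra.
by lra.
Qed.

End PartialSums.

(** * Partial strategyproofness of mechanisms and hybrids *)

Section Mechanisms.
Variables (R : realType) (N M : finType) (q : M -> nat).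
Implicit Types (chi phi psi : mechanism R N q) (t : iteration N M).

Lemma sum_delta chi t : \sum_j delta chi t j = 0.
Proof.
case: t => [[i P] Q]; rewrite /delta sumrB.
by case: (mech_assignment chi P) (mech_assignment chi (upd P i Q))
  => [_ -> _] [_ -> _]; rewrite subrr.
Qed.

(** Both directions apply the results on utilities to [delta chi], whose entries sum to zero;
    [0 < rho] excludes the convention for 0. *)
Lemma partially_strategyproofE chi (rho : R) : 0 < rho <= 1 ->
  partially_strategyproof rho chi <->
  (forall (i : N) (P : profile N M) (Q : pref M) K,
    0 <= partial_sum rho (P i) (delta chi (i, P, Q)) K).
Proof.
case/andP=> rho0 rho1; split=> [[r0|psp] i P Q|ge0].
- by rewrite r0 ltxx in rho0.
- by apply: inner_ge0_partial_sums => // u; apply: psp.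
- right=> i P Q u _ urbi.
  exact: (partial_sums_inner_ge0 rho0 (sum_delta chi (i, P, Q)) urbi).
Qed.

Lemma partial_sum_rho0 (P : pref M) (d : M -> R) K : partial_sum 0 P d K = 0.
Proof. by rewrite /partial_sum big1 // => k _; rewrite expr0n mulr0. Qed.

(** For [rho > 0], strategyproofness covers the URBI utilities in particular; for [rho = 0] all sums
    vanish. *)
Lemma strategyproof_partial_sums phi (rho : R) : 0 <= rho <= 1 ->
  strategyproof phi ->
  forall (i : N) (P : profile N M) (Q : pref M) K,
    0 <= partial_sum rho (P i) (delta phi (i, P, Q)) K.
Proof.
case/andP; rewrite le_eqVlt => /predU1P[<-|rho0] rho1 sp.
  by move=> i P Q K; rewrite partial_sum_rho0.
apply/partially_strategyproofE; first by rewrite rho0.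
by right=> i P Q u cu _; apply: sp.
Qed.

Lemma partial_sum_hybrid phi psi (rho b : R) (hb : 0 <= b <= 1)
    (P : pref M) t K :
  partial_sum rho P (delta (hybrid phi psi hb) t) K =
  (1 - b) * partial_sum rho P (delta phi t) K
  + b * partial_sum rho P (delta psi t) K.
Proof.
case: t => [[i P'] Q]; rewrite /partial_sum !mulr_sumr -big_split /=.
by apply: eq_bigr => k _; ring.
Qed.

End Mechanisms.

(** * The loop invariant of BetaMax *)

Section Algorithm.
Variables (R : realType) (N M : finType) (q : M -> nat).
Variables (phi psi : mechanism R N q) (rho : R).
Implicit Types (t : iteration N M) (todo : {set iteration N M}) (b : R).

Let pphi t := partial_sum rho (t.1.2 t.1.1) (delta phi t).
Let ppsi t := partial_sum rho (t.1.2 t.1.1) (delta psi t).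

Hypothesis pphi_ge0 : forall t K, 0 <= pphi t K.

(** The bound on the mixing factor contributed by one pass of the inner loop, void when [K] is
    skipped. *)
Definition below_ratio b t K : Prop :=
  ppsi t K < 0 -> b <= pphi t K / (pphi t K - ppsi t K).

Lemma ratio_den_gt0 t K : ppsi t K < 0 -> 0 < pphi t K - ppsi t K.
Proof. by have := pphi_ge0 t K; lra. Qed.

(** Clearing the positive denominator turns the ratio bound into nonnegativity of the mixed sum; if
    [ppsi t K] is nonnegative, that sum is a convex combination of nonnegative numbers. *)
Lemma below_ratioE b t K : 0 <= b <= 1 ->
  below_ratio b t K <-> 0 <= (1 - b) * pphi t K + b * ppsi t K.
Proof.
move=> b01; have p0 := pphi_ge0 t K; split=> [br|h lt0].
  have [ge0|lt0] := leP 0 (ppsi t K); first by nra.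
  by have := br lt0; rewrite ler_pdivlMr ?ratio_den_gt0 //; lra.
by rewrite ler_pdivlMr ?ratio_den_gt0 //; lra.
Qed.

Lemma below_ratio_le b b' t K :
  b' <= b -> below_ratio b t K -> below_ratio b' t K.
Proof. by move=> bb br /br; apply: le_trans. Qed.

(** [b] meets the constraints processed so far and dominates every factor meeting all of them, hence
    is the maximum once [done] covers every pair. *)
Definition extremal (done : iteration N M -> 'I_#|M| -> Prop) b : Prop :=
  [/\ 0 <= b <= 1, forall t K, done t K -> below_ratio b t K
    & forall b', b' <= 1 -> (forall t K, below_ratio b' t K) -> b' <= b].

Lemma extremal_skip (done done' : iteration N M -> 'I_#|M| -> Prop) b :
  (forall t K, done' t K -> done t K \/ ~~ (ppsi t K < 0)) ->
  extremal done b -> extremal done' b.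
Proof.
move=> sub [b01 br opt]; split=> // t K /sub[/br//|nlt0].
by rewrite /below_ratio (negbTE nlt0).
Qed.

(** The minimum keeps the old bounds and adds the new one; a competitor meeting all constraints lies
    below both arguments. *)
Lemma extremal_update (done done' : iteration N M -> 'I_#|M| -> Prop) b t K :
  ppsi t K < 0 ->
  (forall t' K', done' t' K' -> done t' K' \/ t' = t /\ K' = K) ->
  extremal done b ->
  extremal done' (Num.min b (pphi t K / (pphi t K - ppsi t K))).
Proof.
move=> lt0 sub [/andP[b0 b1] br opt]; split.
- by rewrite le_min ge_min b0 b1 divr_ge0 // ltW // ratio_den_gt0.
- move=> t' K' /sub[/br|[-> ->] _]; last by rewrite ge_min lexx orbT.
  by apply: below_ratio_le; rewrite ge_min lexx.
- by move=> b' b'1 b'br; rewrite le_min opt //=; apply: b'br.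
Qed.

(** [InnerLoop] does not store its iteration, hence the existential [t]; pairs of [t] with [K] still
    in [Ks] do not count as processed. *)
Definition invariant (c : config R N M) : Prop :=
  match c with
  | OuterLoop todo b => extremal (fun t _ => t \notin todo) b
  | InnerLoop todo Pi dphi dpsi Ks b => exists t,
      [/\ Pi = t.1.2 t.1.1, dphi = delta phi t, dpsi = delta psi t
        & extremal (fun t' K => t' \notin todo /\ (t' = t -> K \notin Ks)) b]
  | Return b => extremal (fun _ _ => True) b
  end.

Lemma invariant_init : invariant (BetaMax_init R N M).
Proof. by split=> [|t K|b' //]; [rewrite ler01 lexx | rewrite inE]. Qed.

Lemma invariant_step c c' :
  step phi psi rho c c' -> invariant c -> invariant c'.
Proof.
case=> {c c'} /=.
- move=> todo b i P Q _ inv; exists (i, P, Q); split=> //.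
  (* At entry [Ks] is full, so no pair of the entered iteration counts as processed. *)
  apply: extremal_skip inv => t K.
  rewrite !inE negb_and negbK => -[/orP[/eqP->|] h]; last by left.
  by have := h erefl.
- move=> todo Pi dphi dpsi Ks K b _ lt0 _ [t [ePi ephi epsi inv]].
  exists t; split=> //; rewrite ePi ephi epsi in lt0 *.
  (* Removing [K] from [Ks] can add only the pair of [t] and [K] to the processed ones. *)
  apply: extremal_update lt0 _ inv => t' K' [t'todo].
  rewrite !inE negb_and negbK.
  case: (eqVneq t' t) t'todo => [->|ne] t'todo h; last first.
    by left; split=> // e; rewrite e eqxx in ne.
  by case/orP: (h erefl) => [/eqP->|KKs]; [right | left].
- move=> todo Pi dphi dpsi Ks K b _ nlt0 [t [ePi ephi epsi inv]].
  exists t; split=> //; rewrite ePi epsi in nlt0.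
  apply: extremal_skip inv => t' K' [t'todo].
  rewrite !inE negb_and negbK.
  case: (eqVneq t' t) t'todo => [->|ne] t'todo h; last first.
    by left; split=> // e; rewrite e eqxx in ne.
  by case/orP: (h erefl) => [/eqP->|KKs]; [right | left].
- move=> todo Pi dphi dpsi b [t [_ _ _ inv]].
  by apply: extremal_skip inv => t' K t'todo; left; split; rewrite ?inE.
- by move=> b; apply: extremal_skip => t K _; left; rewrite inE.
Qed.

(** * Progress and termination *)

Lemma invariant_progress c : invariant c ->
  (exists b, c = Return N M b) \/ exists c', step phi psi rho c c'.
Proof.
case: c => [todo b|todo Pi dphi dpsi Ks b|b] inv; last by left; exists b.
- right; case: (set_0Vmem todo) => [->|[[[i P] Q] todoP]].
    by exists (Return N M b); constructor.
  by eexists; apply: StepEnter todoP.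
- right; case: inv => t [-> -> -> _].
  case: (set_0Vmem Ks) => [->|[K KKs]].
    by exists (OuterLoop todo b); constructor.
  case: (boolP (ppsi t K < 0)) => [lt0|nlt0]; last first.
    by eexists; apply: StepSkip KKs nlt0.
  (* Since [ppsi t K < 0 <= pphi t K], the division is defined and the machine cannot get stuck. *)
  by eexists; apply: StepUpdate KKs lt0 (lt0r_neq0 (ratio_den_gt0 lt0)).
Qed.

(** The exact number of remaining steps: each pending iteration takes one to enter, [#|M|] for the
    values of [K] and one to leave; the final return takes one more. *)
Definition steps_left (c : config R N M) : nat :=
  match c with
  | OuterLoop todo _ => (#|todo| * #|M|.+2).+1
  | InnerLoop todo _ _ _ Ks _ => #|todo| * #|M|.+2 + #|Ks|.+2
  | Return _ => 0
  end.

Lemma step_steps_left c c' :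
  step phi psi rho c c' -> (steps_left c' < steps_left c)%N.
Proof.
case=> {c c'} /=.
- move=> todo b i P Q todoP; rewrite (cardsD1 (i, P, Q) todo) todoP.
  by rewrite cardsT card_ord add1n mulSn addnC.
- move=> todo Pi dphi dpsi Ks K b /= KKs _ _.
  by rewrite (cardsD1 K Ks) KKs ltn_add2l.
- move=> todo Pi dphi dpsi Ks K b KKs _.
  by rewrite (cardsD1 K Ks) KKs ltn_add2l.
- by move=> todo Pi dphi dpsi b; rewrite cards0 addn2.
- by move=> b; rewrite cards0.
Qed.

Lemma invariant_halts c : invariant c -> halts phi psi rho c.
Proof.
have [n] := ubnP (steps_left c); elim: n c => // n IH c lt_n inv.
case: (invariant_progress inv) => [[b ->]|ex]; first exact: HaltsReturn.
apply: HaltsStep => // c' cc'; apply: IH; last exact: invariant_step inv.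
by apply: leq_trans (step_steps_left cc') _; rewrite -ltnS.
Qed.

(** * Correctness of the returned value *)

Lemma invariant_reachable c c' :
  clos_refl_trans _ (step phi psi rho) c c' -> invariant c -> invariant c'.
Proof.
elim=> {c c'} [c c' /invariant_step//|//|c1 c2 c3 _ h12 _ h23 inv].
exact/h23/h12.
Qed.

(** For [rho > 0], [below_ratioE] identifies the constraints with nonnegativity of the hybrid's
    partial sums, so [extremal] gives both membership and maximality. *)
Lemma maximal_mixing_factor_extremal b : 0 <= rho <= 1 ->
  extremal (fun _ _ => True) b -> is_maximal_mixing_factor phi psi rho b.
Proof.
case/andP; rewrite le_eqVlt => /predU1P[rho0 _|rho0 rho1] [b01 br opt].
  (* At [rho = 0] every factor in the unit interval is feasible by convention and every constraint
     is void, so [b] dominates them all. *)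
  split; first by exists b01; left.
  move=> b' [/andP[_ b'1] _]; apply: opt => // t K.
  by rewrite /below_ratio /ppsi -rho0 partial_sum_rho0 ltxx.
have rho01 : 0 < rho <= 1 by rewrite rho0.
split.
  exists b01; apply/partially_strategyproofE => // i P Q K.
  rewrite partial_sum_hybrid; apply/(below_ratioE (i, P, Q)) => //.
  exact: br.
move=> b' [b'01 /partially_strategyproofE psp].
apply: opt => [|[[i P] Q] K]; first by case/andP: (b'01).
by apply/below_ratioE => //; have := psp rho01 i P Q K;
  rewrite partial_sum_hybrid.
Qed.

End Algorithm.

Theorem proposition4 (R : realType) (N M : finType) (q : M -> nat)
    (hq : setting N q) (phi psi : mechanism R N q)
    (hadm : hybrid_admissible phi psi) (rho : R) (hrho : 0 <= rho <= 1) :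
  BetaMax_terminates phi psi rho /\
  (forall b : R, BetaMax_returns phi psi rho b ->
     is_maximal_mixing_factor phi psi rho b).
Proof.
have [sp _ _] := hadm.
(* Strategyproofness of [phi] supplies the nonnegativity that keeps all denominators positive. *)
have phi_ge0 (t : iteration N M) K :
    0 <= partial_sum rho (t.1.2 t.1.1) (delta phi t) K.
  by case: t => [[i P] Q]; apply: strategyproof_partial_sums.
split; first by apply: invariant_halts => //; apply: invariant_init.
move=> b /(invariant_reachable phi_ge0)/(_ (invariant_init _ _ _)).
exact: maximal_mixing_factor_extremal.
Qed.
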